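(* Let $T\in(0,\infty)$, let $(\Omega,\mathcal F,\mathbb P)$ be a probability space, and let $(E,\|\cdot\|_E)$ be an $\mathbb R$-Banach space. Then for all $p\in(1,\infty)$, $\varepsilon\in(\frac1p,1]$, $\alpha\in[0,\varepsilon-\frac1p)$ there exists $C\in(0,\infty)$ such that for all $\beta\in[\varepsilon,1]$, all $N\in\mathbb N=\{1,2,3,\dots\}$, and all $(\mathcal F,\|\cdot\|_E)$-strongly measurable stochastic processes $X,Y\colon[0,T]\times\Omega\to E$ with continuous sample paths it holds that $$\Bigl(\mathbb E\bigl[\|X-[Y]_N\|^p_{\mathcal C^\alpha([0,T],\|\cdot\|_E)}\bigr]\Bigr)^{1/p}\le C\,N^\varepsilon\Bigl(\sup_{n\in\{0,1,\dots,N\}}\bigl\|X_{\frac{nT}{N}}-Y_{\frac{nT}{N}}\bigr\|_{\mathcal L^p(\mathbb P;\|\cdot\|_E)}+N^{-\beta}\,\|X\|_{\mathcal C^\beta([0,T],\|\cdot\|_{\mathcal L^p(\mathbb P;\|\cdot\|_E)})}\Bigr).$$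
   Context: For a function $f\colon[0,T]\to E$ and $N\in\mathbb N$, $[f]_N\colon[0,T]\to E$ is the piecewise affine linear interpolation of $f$ at the points $0,\frac TN,\frac{2T}N,\dots,T$: for all $n\in\{0,1,\dots,N-1\}$, $t\in[\frac{nT}N,\frac{(n+1)T}N]$, $[f]_N(t)=(n+1-\frac{tN}T)f(\frac{nT}N)+(\frac{tN}T-n)f(\frac{(n+1)T}N)$. For a process $Y$, $[Y]_N$ is the process obtained by applying this to each sample path. A stochastic process $X\colon[0,T]\times\Omega\to E$ is $(\mathcal F,\|\cdot\|_E)$-strongly measurable if each $X_t\colon\Omega\to E$ is strongly measurable. For a strongly measurable $Z\colon\Omega\to E$ put $\|Z\|_{\mathcal L^p(\mathbb P;\|\cdot\|_E)}=(\mathbb E[\|Z\|_E^p])^{1/p}\in[0,\infty]$. For a metric space $(M,d)$, a vector space $V$ equipped with a seminorm $\|\cdot\|$ which is allowed to take the value $\infty$, $r\in[0,1]$ and $f\colon M\to V$ put $|f|_{\mathcal C^r(M,\|\cdot\|)}=\sup(\{\|f(x)-f(y)\|/d(x,y)^r\colon x,y\in M,\ x\neq y\}\cup\{0\})\in[0,\infty]$, $\|f\|_{C(M,\|\cdot\|)}=\sup(\{\|f(x)\|\colon x\in M\}\cup\{0\})$, and $\|f\|_{\mathcal C^r(M,\|\cdot\|)}=\|f\|_{C(M,\|\cdot\|)}+|f|_{\mathcal C^r(M,\|\cdot\|)}$. In $\|X\|_{\mathcal C^\beta([0,T],\|\cdot\|_{\mathcal L^p(\mathbb P;\|\cdot\|_E)})}$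 the process $X$ is regarded as the function $t\mapsto X_t$ with values in the strongly measurable functions from $\Omega$ to $E$; in $\|X-[Y]_N\|_{\mathcal C^\alpha([0,T],\|\cdot\|_E)}$ the norm is taken for each sample path. *)

(* Defs.v *)
From HB Require Import structures.
From mathcomp Require Import all_boot all_order all_algebra.
From mathcomp Require Import all_classical all_reals all_analysis.

Set Implicit Arguments.
Unset Strict Implicit.
Unset Printing Implicit Defensive.

Import Order.TTheory GRing.Theory Num.Theory.
Import numFieldNormedType.Exports.

Local Open Scope classical_set_scope.
Local Open Scope ring_scope.

(* Strong measurability: pointwise limit of measurable functions with finitely
   many values (for such functions, measurability of the fibres is Borel
   measurability). *)
Definition simple_function (d : measure_display) (Omega : measurableType d)
    (E : Type) (s : Omega -> E) : Prop :=
  finite_set (range s) /\ forall y : E, measurable (s @^-1` [set y]).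

Definition strongly_measurable (d : measure_display) (Omega : measurableType d)
    (E : topologicalType) (Z : Omega -> E) : Prop :=
  exists s : nat -> Omega -> E,
    (forall k, simple_function (s k)) /\
    (forall w, (fun k => s k w) @ \oo --> Z w).

Definition Lp_norm (R : realType) (E : normedModType R) (d : measure_display)
    (Omega : measurableType d) (P : probability Omega R) (p : R)
    (Z : Omega -> E) : \bar R :=
  Lnorm P p%:E (fun w => `|Z w|%:E).

(* In what follows the metric space on which f is considered is the subset D of
   M, and nrm is a seminorm on V that may take the value +oo. *)
Definition sup_norm (R : realType) (M : Type) (V : Type)
    (D : set M) (nrm : V -> \bar R) (f : M -> V) : \bar R :=
  ereal_sup ([set nrm (f x) | x in D] `|` [set 0%E]).

Definition holder_seminorm (R : realType) (M : metricType R) (V : zmodType)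
    (r : R) (D : set M) (nrm : V -> \bar R) (f : M -> V) : \bar R :=
  ereal_sup
    ([set e : \bar R | exists x y : M, [/\ D x, D y, x != y &
        e = (nrm (f x - f y)%R * ((mdist x y `^ r)^-1)%:E)%E]]
     `|` [set 0%E]).

Definition holder_norm (R : realType) (M : metricType R) (V : zmodType)
    (r : R) (D : set M) (nrm : V -> \bar R) (f : M -> V) : \bar R :=
  (sup_norm D nrm f + holder_seminorm r D nrm f)%E.

Lemma mdist_real (R : realType) (x y : R) :
  mdist (x : R^o) (y : R^o) = `|x - y|.
Proof. exact: distrC. Qed.

(* The index n of a grid interval [nT/N, (n+1)T/N] containing t is taken as
   min(floor(tN/T), N-1); the choice is irrelevant, see interpE. *)
Definition interp (R : realType) (E : lmodType R) (T : R) (N : nat)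
    (f : R -> E) (t : R) : E :=
  let n := minn (Num.truncn (t * N%:R / T)) N.-1 in
  (n.+1%:R - t * N%:R / T) *: f (n%:R * T / N%:R) +
  (t * N%:R / T - n%:R) *: f (n.+1%:R * T / N%:R).

Lemma interpE (R : realType) (E : lmodType R) (T : R) (N : nat) (f : R -> E)
    (n : nat) (t : R) :
  0 < T -> (n < N)%N -> n%:R * T / N%:R <= t <= n.+1%:R * T / N%:R ->
  interp T N f t = (n.+1%:R - t * N%:R / T) *: f (n%:R * T / N%:R) +
                   (t * N%:R / T - n%:R) *: f (n.+1%:R * T / N%:R).
Proof.
move=> T0 nN /andP[tn tn1].
have N0 : (0 : R) < N%:R by rewrite ltr0n (leq_ltn_trans _ nN).
have xn : n%:R <= t * N%:R / T.
  by rewrite ler_pdivlMr// -ler_pdivrMr.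
have xn1 : t * N%:R / T <= n.+1%:R.
  by rewrite ler_pdivrMr// -ler_pdivlMr.
rewrite /interp; set x := t * N%:R / T in xn xn1 *.
move: xn1; rewrite le_eqVlt => /orP[/eqP xE|xlt]; last first.
  have -> : Num.truncn x = n by apply: truncn_def; rewrite xn xlt.
  by rewrite (minn_idPl _)// -ltnS prednK// (leq_ltn_trans _ nN).
rewrite xE natrK.
have [nN1|nN1] := leqP n.+1 N.-1; last first.
  suff -> : N.-1 = n by [].
  by apply/eqP; rewrite eqn_leq -ltnS nN1 -ltnS prednK// (leq_ltn_trans _ nN).
by rewrite !subrr !scale0r addr0 -natrB// subSnn scale1r
           -natrB// subSnn scale1r add0r.
Qed.

(* Main.v *)
(* Rescale time by x = t N / T, so that the grid becomes {0, ..., N}, and put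
   q = 2^-gamma with alpha < gamma < eps - 1/p.  On each path let G be the sum,
   over all levels l, grid cells n and j < 2^l, of q^(-l p) times the p-th power
   of the increment of X along the j-th dyadic interval of level l of the n-th
   cell, plus the sum over the grid of the p-th powers of |X - Y|.  Dyadic
   chaining bounds the oscillation of X inside the cells by G^(1/p); this, the
   grid errors |X - Y| <= G^(1/p) and the piecewise affine form of [Y]_N bound
   the alpha-Hölder norm of X - [Y]_N by a constant times N^alpha G^(1/p).
   Finally E[G] is bounded termwise by a geometric series times N, because
   beta >= eps > gamma + 1/p; the extra factor N^(1/p) is absorbed by
   alpha + 1/p < eps. *)

Require Import Defs.
From HB Require Import structures.
From mathcomp Require Import all_boot all_order all_algebra.
From mathcomp Require Import all_classical all_reals all_analysis.
From mathcomp Require Import measurable_realfun.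
From mathcomp Require Import ring lra zify.

Set Implicit Arguments.
Unset Strict Implicit.
Unset Printing Implicit Defensive.

Import Order.TTheory GRing.Theory Num.Theory.
Import numFieldNormedType.Exports.

Local Open Scope classical_set_scope.
Local Open Scope ring_scope.

(** * Dyadic chaining *)

Definition dyadic_floor (R : realType) (l : nat) (u : R) : R :=
  (Num.truncn (u * 2 ^+ l))%:R / 2 ^+ l.

Lemma dyadic_floor_itv (R : realType) (l : nat) (u : R) : 0 <= u ->
  dyadic_floor l u <= u < dyadic_floor l u + 2 ^- l.
Proof.
move=> u0; have l0 : (0 : R) < 2 ^+ l by rewrite exprn_gt0.
have /truncn_itv : 0 <= u * 2 ^+ l by rewrite mulr_ge0// ltW.
rewrite /dyadic_floor ler_pdivrMr// -ltr_pdivlMr// => /andP[-> /=].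
by rewrite -natr1 mulrDl mul1r.
Qed.

(** Refining by one dyadic level therefore leaves the floor in place or moves it right by exactly
    one step of the finer level. *)
Lemma truncn_double (R : realType) (x : R) : 0 <= x ->
  Num.truncn (x * 2) = (Num.truncn x).*2 \/
  Num.truncn (x * 2) = (Num.truncn x).*2.+1.
Proof.
move=> x0; have /andP[x1 x2] := truncn_itv x0.
have x20 : 0 <= x * 2 by rewrite mulr_ge0.
have : ((Num.truncn x).*2 <= Num.truncn (x * 2))%N.
  by rewrite truncn_ge_nat// -muln2 natrM ler_wpM2r.
have : (Num.truncn (x * 2) < (Num.truncn x).+1.*2)%N.
  by rewrite truncn_lt_nat// -muln2 natrM ltr_pM2r.
by lia.
Qed.

Section chaining.
Context (R : realType) (E : normedModType R) (g : R -> E) (q M : R).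
Hypotheses (q01 : 0 < q < 1) (M0 : 0 <= M).
Hypothesis gc : {within `[0, 1], continuous g}.
Hypothesis gincr : forall l j, (j < 2 ^ l)%N ->
  `|g (j.+1%:R / 2 ^+ l) - g (j%:R / 2 ^+ l)| <= M * q ^+ l.

Lemma dyadic_floor_incr l u : 0 <= u <= 1 ->
  `|g (dyadic_floor l.+1 u) - g (dyadic_floor l u)| <= M * q ^+ l.+1.
Proof.
move=> /andP[u0 u1]; have /andP[q0 _] := q01.
have l0 : (0 : R) < 2 ^+ l by rewrite exprn_gt0.
have ul0 : 0 <= u * 2 ^+ l by rewrite mulr_ge0// ltW.
(* The floor of level [l] is rewritten with an even numerator over [2 ^+ l.+1], so that both floors
   lie on one grid. *)
have dE : dyadic_floor l u = (Num.truncn (u * 2 ^+ l)).*2%:R / 2 ^+ l.+1.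
  rewrite /dyadic_floor exprSr -muln2 natrM; field.
  by rewrite lt0r_neq0.
rewrite dE {1}/dyadic_floor.
have := truncn_double ul0; rewrite -mulrA -exprSr.
set m := Num.truncn (u * 2 ^+ l) => -[mE|mE]; rewrite mE.
  by rewrite subrr normr0 mulr_ge0// exprn_ge0// ltW.
(* In the odd case the numerator [m.*2.+1] is at most [2 ^ l.+1] because [u <= 1], so the interval
   starting at index [m.*2] lies inside [0, 1]. *)
apply: gincr; rewrite -(ltr_nat R) natrX.
have /truncn_itv /andP[+ _] : 0 <= u * 2 ^+ l.+1.
  by rewrite mulr_ge0// exprn_ge0.
rewrite mE => mu; apply: (@lt_le_trans _ _ m.*2.+1%:R); first by rewrite ltr_nat.
by apply: (le_trans mu); rewrite ler_piMl// exprn_ge0.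
Qed.

Lemma dyadic_floor_tail k n u : 0 <= u <= 1 ->
  `|g (dyadic_floor (k + n) u) - g (dyadic_floor k u)| <= M * q ^+ k.+1 / (1 - q).
Proof.
move=> u01; have /andP[q0 q1] := q01.
have Q : 0 < 1 - q by rewrite subr_gt0.
(* The induction on [n] carries the exact partial geometric sum; the bound in the statement, being
   free of [n], would not pass through the step. *)
apply: (@le_trans _ _ (M * (q ^+ k.+1 - q ^+ (k + n).+1) / (1 - q))); last first.
  rewrite ler_pM2r ?invr_gt0// ler_wpM2l// lerBlDr lerDl exprn_ge0//.
  exact: ltW.
elim: n => [|n IHn]; first by rewrite addn0 !subrr normr0 mulr0 mul0r.
rewrite addnS; set a := g (dyadic_floor (k + n).+1 u).
rewrite -(subrKA (g (dyadic_floor (k + n) u))).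
apply: (le_trans (ler_normD _ _)).
apply: (le_trans (lerD (dyadic_floor_incr _ u01) IHn)).
rewrite le_eqVlt; apply/orP; left; apply/eqP.
by rewrite [q ^+ (k + n).+2]exprS; field; rewrite lt0r_neq0.
Qed.

Lemma cvg_dyadic_floor u : 0 <= u <= 1 ->
  g (dyadic_floor n u) @[n --> \oo] --> g u.
Proof.
move=> u01; have /andP[u0 u1] := u01.
move/subspace_continuousP : gc => /(_ u); rewrite /= in_itv/= => /(_ u01) gu.
apply: cvg_comp gu.
have du : dyadic_floor n u @[n --> \oo] --> u.
  apply/cvgrPdist_le => e e0.
  near=> n.
  have /andP[d1 d2] := dyadic_floor_itv n u0.
  rewrite ger0_norm ?subr_ge0// lerBlDr.
  apply: (le_trans (ltW d2)); rewrite addrC lerD2r.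
  near: n.
  have : geometric (1 : R) 2^-1 n @[n --> \oo] --> 0.
    by apply: cvg_geometric; rewrite ger0_norm ?invr_ge0// invf_lt1// ltr1n.
  move/cvgrPdist_le => /(_ e e0); apply: filterS => n.
  by rewrite sub0r normrN/= mul1r exprVn ger0_norm// invr_ge0 exprn_ge0.
(* Continuity of [g] is only relative to [0, 1], so the approximating floors must be checked to stay
   there: they lie between 0 and [u]. *)
move=> A /=; rewrite /within/= => uA.
have := du _ uA; rewrite /nbhs/=; apply: filterS => n /=; apply.
rewrite in_itv/= divr_ge0 ?exprn_ge0//=.
have /andP[+ _] := dyadic_floor_itv n u0.
by move=> /le_trans; apply.
Unshelve. all: by end_near.
Qed.

Lemma dyadic_floor_approx k u : 0 <= u <= 1 ->
  `|g u - g (dyadic_floor k u)| <= M * q ^+ k.+1 / (1 - q).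
Proof.
move=> u01.
have : `|g (dyadic_floor n u) - g (dyadic_floor k u)| @[n --> \oo] -->
    `|g u - g (dyadic_floor k u)|.
  by apply: cvg_norm; apply: cvgB; [exact: cvg_dyadic_floor|exact: cvg_cst].
move=> /cvg_lim <- //; apply: limr_le.
  apply/cvg_ex; exists `|g u - g (dyadic_floor k u)|.
  by apply: cvg_norm; apply: cvgB; [exact: cvg_dyadic_floor|exact: cvg_cst].
near=> n; have kn : (k <= n)%N by near: n; exact: nbhs_infty_ge.
by rewrite -(subnKC kn); exact: dyadic_floor_tail.
Unshelve. all: by end_near.
Qed.

(** After scaling by [2 ^+ k] the two points differ by at most 1, so their truncations agree or are
    consecutive, and a single instance of [gincr] suffices. *)
Lemma dyadic_floor_close k u v : 0 <= u -> u <= v -> v <= 1 -> v - u <= 2 ^- k ->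
  `|g (dyadic_floor k v) - g (dyadic_floor k u)| <= M * q ^+ k.
Proof.
move=> u0 uv v1 vu; have /andP[q0 q1] := q01.
have k0 : (0 : R) < 2 ^+ k by rewrite exprn_gt0.
have v0 := le_trans u0 uv.
have uk0 : 0 <= u * 2 ^+ k by rewrite mulr_ge0// ltW.
have vk0 : 0 <= v * 2 ^+ k by rewrite mulr_ge0// ltW.
have /andP[um1 um2] := truncn_itv uk0.
have /andP[vm1 vm2] := truncn_itv vk0.
have uvk : u * 2 ^+ k <= v * 2 ^+ k by rewrite ler_pM2r.
have vk1 : v * 2 ^+ k <= 2 ^+ k by rewrite ler_piMl// ltW.
have uvk1 : v * 2 ^+ k < (Num.truncn (u * 2 ^+ k)).+2%:R.
  apply: (@le_lt_trans _ _ (u * 2 ^+ k + 1)); last by rewrite -[ltRHS]natr1 ltrD2r.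
  by rewrite -lerBlDl -mulrBl -ler_pdivlMr// mul1r.
have : (Num.truncn (u * 2 ^+ k) <= Num.truncn (v * 2 ^+ k))%N.
  by rewrite truncn_ge_nat// (le_trans um1).
have : (Num.truncn (v * 2 ^+ k) < (Num.truncn (u * 2 ^+ k)).+2)%N.
  by rewrite truncn_lt_nat.
have : (Num.truncn (v * 2 ^+ k) <= 2 ^ k)%N.
  by rewrite -(ler_nat R) natrX (le_trans vm1).
rewrite /dyadic_floor.
move: (Num.truncn (v * 2 ^+ k)) (Num.truncn (u * 2 ^+ k)) => j i jk ji ij.
have [->|jE] : j = i \/ j = i.+1 by clear -ji ij; lia.
  by rewrite subrr normr0 mulr_ge0// exprn_ge0// ltW.
by rewrite jE; apply: gincr; rewrite -jE.
Qed.

(** The increment is routed from [u] to its floor of level [k], then to the floor of [v], then to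
    [v]. The two outer legs cost a geometric tail each, the middle one a single step. *)
Lemma dyadic_chaining k u v : 0 <= u <= 1 -> 0 <= v <= 1 -> `|v - u| <= 2 ^- k ->
  `|g v - g u| <= 2 * M / (1 - q) * q ^+ k.
Proof.
wlog uv : u v / u <= v => [hw|].
  move=> u01 v01 vu; have [uv|/ltW uv] := leP u v; first exact: hw.
  by rewrite distrC; apply: hw => //; rewrite distrC.
move=> u01 v01; have /andP[u0 u1] := u01; have /andP[v0 v1] := v01.
have /andP[q0 q1] := q01.
rewrite ger0_norm ?subr_ge0// => /(dyadic_floor_close u0 uv v1) guv.
have -> : g v - g u = (g v - g (dyadic_floor k v)) +
    (g (dyadic_floor k v) - g (dyadic_floor k u)) + (g (dyadic_floor k u) - g u).
  by rewrite !subrKA.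
apply: (le_trans (ler_normD _ _)).
have := dyadic_floor_approx k u01; rewrite distrC => gu.
apply: (le_trans (lerD (ler_normD _ _) gu)).
apply: (le_trans (lerD (lerD (dyadic_floor_approx k v01) guv) (lexx _))).
have Q : 0 < 1 - q by rewrite subr_gt0.
have Mq : 0 <= M * q ^+ k by rewrite mulr_ge0// exprn_ge0// ltW.
(* The three legs add up to [(1 + q) / (1 - q)] times [M * q ^+ k]; replacing [1 + q] by 2 leaves a
   slack of exactly [M * q ^+ k]. *)
rewrite exprS -subr_ge0 [leRHS](_ : _ = M * q ^+ k).
  by [].
by field; rewrite lt0r_neq0.
Qed.

End chaining.

Lemma powR_exprn (R : realType) (x p : R) (l : nat) : 0 <= x ->
  (x ^+ l) `^ p = (x `^ p) ^+ l.
Proof.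
by move=> x0; rewrite -(powR_mulrn l (powR_ge0 x p)) -(powR_mulrn l x0) powRAC.
Qed.

Lemma powR_half (R : realType) (x : R) : 2^-1 `^ x = 2 `^ (- x).
Proof. by rewrite -(powR_inv1 (ler0n R 2)) -powRrM mulN1r. Qed.

Lemma powR2_lt1 (R : realType) (x : R) : x < 0 -> 2 `^ x < 1.
Proof.
move=> x0; rewrite -[ltRHS](powRr0 2) /powR !gt_eqF// ltr_expR.
by rewrite ltr_pM2r// ln_gt0// ltr1n.
Qed.

Lemma dyadic_scale (R : realType) (h : R) : 0 < h <= 1 ->
  exists k, 2 ^- k.+1 < h <= 2 ^- k.
Proof.
move=> /andP[h0 h1].
have ex : exists n, 2 ^- n.+1 < h.
  (* With n the integer part of 1/h, one has 1/h < n + 1 < 2^(n+1). Minimality of the chosen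
     exponent then gives the upper bound on [h]. *)
  exists (Num.truncn h^-1); rewrite -[ltRHS]invrK ltf_pV2 ?posrE ?invr_gt0//.
  have /truncn_itv /andP[_ ] : 0 <= h^-1 by rewrite invr_ge0 ltW.
  by move=> /lt_trans; apply; rewrite -natrX ltr_nat ltn_expl.
case: (ex_minnP ex) => -[|k] kh kmin; first by exists 0; rewrite kh expr0 invr1.
exists k.+1; rewrite kh/= leNgt; by apply/negP => /kmin; rewrite ltnn.
Qed.

(** With k the dyadic scale of |v - u|, q^k = (2^-k)^gamma is at most (2|v - u|)^gamma, hence at
    most 2|v - u|^gamma as gamma <= 1, and at most 2|v - u|^alpha as |v - u| <= 1. This doubles the
    chaining constant 2 to 4. *)
Lemma dyadic_chaining_holder (R : realType) (E : normedModType R) (g : R -> E)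
    (gamma alpha M : R) :
  0 < gamma <= 1 -> 0 <= alpha <= gamma -> 0 <= M ->
  {within `[0, 1], continuous g} ->
  (forall l j, (j < 2 ^ l)%N ->
    `|g (j.+1%:R / 2 ^+ l) - g (j%:R / 2 ^+ l)| <= M * (2 `^ (- gamma)) ^+ l) ->
  forall u v : R, 0 <= u <= 1 -> 0 <= v <= 1 ->
  `|g v - g u| <= 4 * M / (1 - 2 `^ (- gamma)) * `|v - u| `^ alpha.
Proof.
move=> /andP[g0 g1] /andP[a0 ag] M0 gc gincr u v u01 v01.
set q := 2 `^ (- gamma) in gincr *.
have q0 : 0 < q by rewrite powR_gt0.
have q1 : q < 1.
  by rewrite powR2_lt1// oppr_lt0.
have Q : 0 < 1 - q by rewrite subr_gt0.
have c0 : 0 <= 2 * M / (1 - q) by rewrite divr_ge0// ?mulr_ge0// ltW.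
have [->|vu] := eqVneq v u.
  rewrite subrr normr0 mulr_ge0// ?powR_ge0//.
  by rewrite divr_ge0// ?mulr_ge0// ltW.
have h01 : 0 < `|v - u| <= 1.
  rewrite normr_gt0 subr_eq0 vu/= ler_norml.
  by move: u01 v01 => /andP[? ?] /andP[? ?]; apply/andP; split; lra.
have [k /andP[k1 k2]] := dyadic_scale h01; have /andP[h0 h1] := h01.
have := @dyadic_chaining R E g q M _ M0 gc gincr k u v u01 v01 k2.
rewrite q0 q1 => /(_ isT) /le_trans; apply.
have -> : 4 * M / (1 - q) * `|v - u| `^ alpha =
    2 * M / (1 - q) * (2 * `|v - u| `^ alpha).
  by field; rewrite lt0r_neq0.
rewrite ler_wpM2l//.
apply: (@le_trans _ _ (2 * `|v - u| `^ gamma)); last first.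
  by rewrite ler_pM2l//; apply: ger_powR.
apply: (@le_trans _ _ ((2 * `|v - u|) `^ gamma)); last first.
  rewrite powRM//; apply: ler_wpM2r; first exact: powR_ge0.
  by apply: ler1_powR => //; rewrite ler1n.
have -> : q ^+ k = (2 ^- k) `^ gamma.
  by rewrite -exprVn powR_exprn ?invr_ge0// powR_half.
apply: ge0_ler_powR; rewrite ?nnegrE ?invr_ge0 ?exprn_ge0 ?mulr_ge0//; first exact: ltW.
move: k1; rewrite exprS invfM => k1.
by rewrite -ler_pdivrMl// ltW.
Qed.

(** * From grid cells to the whole interval *)

Lemma unit_cell (R : realType) (N : nat) (x : R) : (0 < N)%N -> 0 <= x <= N%:R ->
  exists (n : nat) (u : R), [/\ (n < N)%N, 0 <= u <= 1 & x = n%:R + u].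
Proof.
move=> N0 /andP[x0 xN]; have [->|xNN] := eqVneq x N%:R.
  exists N.-1, 1; split; [by rewrite prednK|by rewrite ler01 lexx|].
  by rewrite natr1 prednK.
have /andP[n1 n2] := truncn_itv x0.
exists (Num.truncn x), (x - (Num.truncn x)%:R); split.
- by rewrite truncn_lt_nat// lt_neqAle xNN.
- by rewrite subr_ge0 n1/= lerBlDl natr1 ltW.
- by rewrite subrKC.
Qed.

Section gluing.
Context (R : realType) (E : normedModType R) (W : R -> E) (N : nat).
Context (alpha L B : R).
Hypotheses (N0 : (0 < N)%N) (a0 : 0 <= alpha) (L0 : 0 <= L) (B0 : 0 <= B).
Hypothesis Wcell : forall (n : nat) (u v : R), (n < N)%N -> 0 <= u <= 1 -> 0 <= v <= 1 ->
  `|W (n%:R + v) - W (n%:R + u)| <= L * `|v - u| `^ alpha.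
Hypothesis Wgrid : forall n, (n <= N)%N -> `|W n%:R| <= B.

Lemma gluing_sup x : 0 <= x <= N%:R -> `|W x| <= L + B.
Proof.
move=> /(unit_cell N0)[n [u [nN u01 ->]]].
rewrite -(subrK (W n%:R) (W _)); apply: (le_trans (ler_normD _ _)).
apply: lerD; last exact/Wgrid/ltnW.
have := Wcell nN (_ : 0 <= 0 <= 1) u01.
rewrite addr0 lexx ler01 => /(_ isT) /le_trans; apply.
rewrite -[leRHS]mulr1 ler_wpM2l// subr0; move: u01 => /andP[u0 u1].
have <- : 1 `^ alpha = 1 :> R by rewrite powR1.
rewrite ger0_norm//; apply: ge0_ler_powR => //.
by rewrite nnegrE.
Qed.

(** Points at distance at least 1 are handled by the sup bound alone. Closer points share a cell or
    lie in adjacent cells, and then the increment splits at the one grid point between them. Hence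
    the constant does not grow with the number of cells. *)
Lemma gluing_holder x y : 0 <= x <= N%:R -> 0 <= y <= N%:R ->
  `|W y - W x| <= 2 * (L + B) * `|y - x| `^ alpha.
Proof.
wlog xy : x y / x <= y => [hw|].
  move=> x01 y01; have [xy|/ltW xy] := leP x y; first exact: hw.
  by rewrite distrC (distrC y); apply: hw.
move=> xN yN; have [yx1|yx1] := leP 1 (y - x).
  apply: (@le_trans _ _ (2 * (L + B))).
    apply: (le_trans (ler_normB _ _)).
    by rewrite mulr_natl mulr2n lerD// gluing_sup.
  rewrite ler_peMr// ?mulr_ge0 ?addr_ge0//.
  have {1}<- : 1 `^ alpha = 1 :> R by rewrite powR1.
  apply: ge0_ler_powR; rewrite ?nnegrE// ?ler01//.
  by rewrite ger0_norm ?subr_ge0.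
have /andP[x0 _] := xN; have /andP[_ y1] := yN.
have [n [u [nN /andP[u0 u1] xE]]] := unit_cell N0 xN.
have h0 := powR_ge0 `|y - x| alpha.
have mono z : 0 <= z -> z <= y - x -> L * `|z| `^ alpha <= L * `|y - x| `^ alpha.
  move=> z0 zy; rewrite ler_wpM2l// ge0_ler_powR ?nnegrE//.
  by rewrite !ger0_norm// subr_ge0.
have [yn|yn] := leP y (n%:R + 1).
  have := @Wcell n u (y - n%:R) nN; rewrite subrKC -xE.
  have -> : y - n%:R - u = y - x by rewrite xE; ring.
  rewrite u0 u1 => /(_ isT) Wyx; apply: (le_trans (Wyx _)).
    by apply/andP; split; lra.
  by rewrite ler_wpM2r// mulr_natl mulr2n ler_wpDr ?addr_ge0// lerDl.
(* Now [y] lies beyond [n + 1] while [y - x < 1], so [y] belongs to the next cell, which exists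
   because [y <= N%:R]. *)
have n1N : (n.+1 < N)%N by rewrite -(ltr_nat R) -natr1; exact: lt_le_trans yn y1.
have e1 : 0 <= u <= 1 by rewrite u0 u1.
have e2 : 0 <= (1 : R) <= 1 by rewrite lexx ler01.
have e3 : 0 <= (0 : R) <= 1 by rewrite lexx ler01.
have := Wcell nN e1 e2; rewrite -xE natr1 => W1.
have e4 : 0 <= y - n.+1%:R <= 1 by rewrite -natr1; apply/andP; split; lra.
have := Wcell n1N e3 e4; rewrite subrKC addr0 subr0 => W2.
rewrite -(subrKA (W n.+1%:R)) (le_trans (ler_normD _ _))//.
apply: (le_trans (lerD W2 W1)).
apply: (@le_trans _ _ (L * `|y - x| `^ alpha + L * `|y - x| `^ alpha)).
  by apply: lerD; apply: mono; rewrite -?natr1; lra.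
by rewrite -mulrDl ler_wpM2r// mulr_natl mulr2n lerD// lerDl.
Qed.

End gluing.

(** * The interpolation error along a single path *)

(** On one cell the interpolant is affine in the rescaled time, so its increment is [v - u] times
    the increment of [Y] across the cell. The latter is compared with that of [X], at the price of
    the errors at the two ends. *)
Lemma interp_error_cell (R : realType) (E : normedModType R) (T : R) (N : nat)
    (X Y : R -> E) (alpha H B : R) (n : nat) :
  0 < T -> (n < N)%N -> alpha <= 1 -> 0 <= H -> 0 <= B ->
  (forall u v : R, 0 <= u <= 1 -> 0 <= v <= 1 ->
    `|X ((n%:R + v) * T / N%:R) - X ((n%:R + u) * T / N%:R)|
      <= H * `|v - u| `^ alpha) ->
  (forall k, (k <= N)%N ->
    `|X (k%:R * T / N%:R) - Y (k%:R * T / N%:R)| <= B) ->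
  let W x := X (x * T / N%:R) - interp T N Y (x * T / N%:R) in
  forall u v : R, 0 <= u <= 1 -> 0 <= v <= 1 ->
    `|W (n%:R + v) - W (n%:R + u)| <= (2 * H + 2 * B) * `|v - u| `^ alpha.
Proof.
move=> T0 nN a1 H0 B0 HX HD W u v u01 v01.
have N0 : (0 : R) < N%:R by rewrite ltr0n (leq_ltn_trans _ nN).
have iE z : 0 <= z <= 1 -> interp T N Y ((n%:R + z) * T / N%:R) =
    Y (n%:R * T / N%:R) + z *: (Y (n.+1%:R * T / N%:R) - Y (n%:R * T / N%:R)).
  move=> /andP[z0 z1]; rewrite (interpE _ T0 nN); last first.
    by rewrite !ler_pM2r ?invr_gt0// lerDl z0/= -natr1 lerD2l.
  have -> : (n%:R + z) * T / N%:R * N%:R / T = n%:R + z.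
    by field; rewrite !lt0r_neq0.
  have -> : n.+1%:R - (n%:R + z) = 1 - z by rewrite -natr1; ring.
  rewrite [n%:R + z]addrC addrK.
  by rewrite scalerBl scale1r scalerBr -addrA (addrC (- _)).
rewrite /W !iE//.
set y0 := Y (n%:R * T / N%:R); set y1 := Y (n.+1%:R * T / N%:R).
set x1 := X ((n%:R + v) * T / N%:R); set x0 := X ((n%:R + u) * T / N%:R).
have -> : x1 - (y0 + v *: (y1 - y0)) - (x0 - (y0 + u *: (y1 - y0))) =
    (x1 - x0) - (v - u) *: (y1 - y0).
  rewrite [- (x0 - _)]opprD addrACA -opprD; congr (_ - _).
  by rewrite opprD addrACA subrr add0r scalerBl.
apply: (le_trans (ler_normB _ _)).
have e2 : 0 <= (1 : R) <= 1 by rewrite lexx ler01.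
have e3 : 0 <= (0 : R) <= 1 by rewrite lexx ler01.
have := HX 0 1 e3 e2; rewrite addr0 natr1 subr0 normr1 powR1 mulr1 => H1.
have y10 : `|y1 - y0| <= H + 2 * B.
  have -> : y1 - y0 = (X (n.+1%:R * T / N%:R) - X (n%:R * T / N%:R)) -
      (X (n.+1%:R * T / N%:R) - y1) + (X (n%:R * T / N%:R) - y0).
    by rewrite opprB [_ - _ + (y1 - _)]addrC !subrKA.
  rewrite (le_trans (ler_normD _ _))// [2 * B]mulr_natl mulr2n addrA lerD//; last first.
    exact/HD/ltnW.
  by rewrite (le_trans (ler_normB _ _))// lerD// HD.
have vu1 : `|v - u| <= 1.
  rewrite ler_norml.
  by move: u01 v01 => /andP[? ?] /andP[? ?]; apply/andP; split; lra.
(* This turns the Lipschitz bound for the affine part into an [alpha]-Hölder bound, using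
   [alpha <= 1] and a distance of at most 1. *)
have vua : `|v - u| <= `|v - u| `^ alpha.
  have [->|vu] := eqVneq `|v - u| 0; first exact: powR_ge0.
  by apply: ger1_powR => //; rewrite vu1 lt0r vu normr_ge0.
apply: (le_trans (lerD (HX _ _ u01 v01) (lexx _))).
rewrite normrZ.
have : `|v - u| * `|y1 - y0| <= `|v - u| `^ alpha * (H + 2 * B) by apply: ler_pM.
by move=> /(lerD (lexx _)) => /(_ (H * `|v - u| `^ alpha)) /le_trans; apply; lra.
Qed.

Lemma holder_norm_le (R : realType) (V : normedModType R) (r a b : R)
    (D : set R) (f : R -> V) : 0 <= a -> 0 <= b ->
  (forall x, D x -> `|f x| <= a) ->
  (forall x y, D x -> D y -> `|f x - f y| <= b * `|x - y| `^ r) ->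
  (holder_norm (M := R^o) r D (fun v : V => `|v|%:E) f <= (a + b)%:E)%E.
Proof.
move=> a0 b0 fa fb; rewrite EFinD; apply: leeD.
  apply: ge_ereal_sup => _ [[x Dx <-]|->]; last by rewrite lee_fin.
  by rewrite lee_fin fa.
apply: ge_ereal_sup => _ [[x [y [Dx Dy xy ->]]]|->]; last by rewrite lee_fin.
have h0 : 0 < `|x - y| `^ r by rewrite powR_gt0// normr_gt0 subr_eq0.
by rewrite mdist_real -EFinM lee_fin ler_pdivrMr//; exact: fb.
Qed.

Lemma within_continuous_comp_itv (R : realType) (E : topologicalType)
    (A B : set R) (phi : R -> R) (f : R -> E) :
  continuous phi -> (forall x, A x -> B (phi x)) ->
  {within B, continuous f} -> {within A, continuous (fun x => f (phi x))}.
Proof.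
move=> phic phiAB /subspace_continuousP fc; apply/subspace_continuousP => x Ax.
apply: cvg_comp (fc _ (phiAB _ Ax)) => U /= U1.
have U2 : \forall y \near x, B (phi y) -> U (phi y) := phic x _ U1.
suff : \forall y \near x, A y -> U (phi y) by [].
by apply: filterS U2 => y yU Ay; exact/yU/phiAB.
Qed.

(** Deterministic core of the proof: chaining on each cell, comparison with the affine interpolant,
    gluing, and undoing the time change. The last operation multiplies the seminorm by
    (N/T)^alpha. *)
Lemma holder_norm_interp_error_le (R : realType) (E : normedModType R) (T : R)
    (N : nat) (X Y : R -> E) (gamma alpha M : R) :
  0 < T -> (0 < N)%N -> 0 < gamma <= 1 -> 0 <= alpha <= gamma -> 0 <= M ->
  {within `[0, T], continuous X} ->
  (forall l n j, (n < N)%N -> (j < 2 ^ l)%N ->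
    `|X ((n%:R + j.+1%:R / 2 ^+ l) * T / N%:R)
      - X ((n%:R + j%:R / 2 ^+ l) * T / N%:R)| <= M * (2 `^ (- gamma)) ^+ l) ->
  (forall n, (n <= N)%N -> `|X (n%:R * T / N%:R) - Y (n%:R * T / N%:R)| <= M) ->
  (holder_norm (M := R^o) alpha `[0%R, T] (fun v : E => `|v|%:E)
     (fun t => (X t - interp T N Y t)%R)
   <= ((8 / (1 - 2 `^ (- gamma)) + 3) * (1 + 2 * T `^ (- alpha))
        * N%:R `^ alpha * M)%:E)%E.
Proof.
move=> T0 N0 g01 ag M0 Xc Xincr XY.
have /andP[g0 g1] := g01; have /andP[a0 a1] := ag.
have NR0 : (0 : R) < N%:R by rewrite ltr0n.
have NR1 : (1 : R) <= N%:R by rewrite ler1n.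
set q := 2 `^ (- gamma) in Xincr *.
have q1 : 0 < 1 - q.
  by rewrite subr_gt0 powR2_lt1// oppr_lt0.
pose H := 4 * M / (1 - q).
have H0 : 0 <= H by rewrite divr_ge0// ?mulr_ge0// ltW.
have cell n : (n < N)%N -> forall u v : R, 0 <= u <= 1 -> 0 <= v <= 1 ->
    `|X ((n%:R + v) * T / N%:R) - X ((n%:R + u) * T / N%:R)|
      <= H * `|v - u| `^ alpha.
  move=> nN u v u01 v01.
  have gc : {within `[0, 1], continuous (fun z => X ((n%:R + z) * T / N%:R))}.
    apply: within_continuous_comp_itv Xc.
      move=> z; apply: cvgM; last exact: cvg_cst.
      apply: cvgM; last exact: cvg_cst.
      by apply: cvgD; [exact: cvg_cst|exact: cvg_id].
    move=> z; rewrite /= !in_itv/= => /andP[z0 z1]; apply/andP; split.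
      by rewrite divr_ge0 ?mulr_ge0 ?addr_ge0// ltW.
    rewrite ler_pdivrMr// mulrC ler_pM2l//.
    by apply: (@le_trans _ _ n.+1%:R); rewrite ?ler_nat// -natr1 lerD2l.
  apply: (dyadic_chaining_holder g01 ag M0 gc _ u01 v01) => l j jl.
  exact: Xincr.
pose W x := X (x * T / N%:R) - interp T N Y (x * T / N%:R).
have L0 : 0 <= 2 * H + 2 * M by rewrite addr_ge0// mulr_ge0.
have Wcell n (u v : R) : (n < N)%N -> 0 <= u <= 1 -> 0 <= v <= 1 ->
    `|W (n%:R + v) - W (n%:R + u)| <= (2 * H + 2 * M) * `|v - u| `^ alpha.
  move=> nN; apply: (interp_error_cell T0 nN) => //; last exact: cell.
  exact: le_trans a1 g1.
have Wgrid n : (n <= N)%N -> `|W n%:R| <= M.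
  move=> nN; rewrite /W; suff -> : interp T N Y (n%:R * T / N%:R) =
      Y (n%:R * T / N%:R) by exact: XY.
  (* No cell starts at [N], so there the interpolant is evaluated at the right end of cell [N.-1];
     every other grid point is the left end of its own cell. *)
  move: nN; rewrite leq_eqVlt => /orP[/eqP ->|nN].
    rewrite (@interpE _ _ _ _ _ N.-1)// prednK//.
      have -> : N%:R * T / N%:R * N%:R / T = N%:R by field; rewrite !lt0r_neq0.
      by rewrite subrr scale0r add0r -natrB ?leq_pred// -subn1 subKn// scale1r.
    by rewrite lexx andbT ler_pM2r ?invr_gt0// ler_pM2r// ler_nat leq_pred.
  rewrite (@interpE _ _ _ _ _ n)//.
    have -> : n%:R * T / N%:R * N%:R / T = n%:R by field; rewrite !lt0r_neq0.
    by rewrite subrr scale0r addr0 -natrB// subSnn scale1r.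
  by rewrite lexx/= ler_pM2r ?invr_gt0// ler_pM2r// ler_nat.
have WE t : X t - interp T N Y t = W (t * N%:R / T).
  have tE : t * N%:R / T * T / N%:R = t by field; rewrite !lt0r_neq0.
  by rewrite /W tE.
have tN t : t \in `[0, T] -> 0 <= t * N%:R / T <= N%:R.
  rewrite in_itv/= => /andP[t0 t1].
  apply/andP; split; first by rewrite divr_ge0// ?mulr_ge0// ltW.
  by rewrite ler_pdivrMr// mulrC ler_pM2l.
(* Lets the sup-norm part, which carries no power of [N], be absorbed into the factor coming from
   the seminorm. *)
have Na : 1 <= N%:R `^ alpha.
  by rewrite -[leLHS](powRr0 N%:R); apply: ler_powR.
set S := 2 * H + 2 * M + M.
have S0 : 0 <= S by rewrite addr_ge0.
(* The 8 is [2 * H] with [H = 4 * M / (1 - q)]; the 3 is the [2 * M] of the cell bound plus the [M]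
   at grid points. *)
have SE : (8 / (1 - q) + 3) * M = S.
  by rewrite /S /H; field; rewrite lt0r_neq0.
apply: le_trans (_ : ((S + 2 * S * (N%:R / T) `^ alpha)%:E <= _)%E).
  apply: holder_norm_le => //.
  - by rewrite !mulr_ge0// powR_ge0.
  - by move=> t tT; rewrite WE; exact: (gluing_sup N0 a0 L0 Wcell Wgrid) (tN _ tT).
  move=> t s tT sT; rewrite !WE.
  have -> : 2 * S * (N%:R / T) `^ alpha * `|t - s| `^ alpha =
      2 * S * `|t * N%:R / T - s * N%:R / T| `^ alpha.
    have -> : `|t * N%:R / T - s * N%:R / T| = N%:R / T * `|t - s|.
      rewrite -!mulrBl -mulrA normrM mulrC; congr (_ * _).
      by rewrite ger0_norm// divr_ge0// ltW.
    by rewrite (powRM _ _ (normr_ge0 _)) ?mulrA// divr_ge0// ltW.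
  exact: (gluing_holder N0 a0 L0 M0 Wcell Wgrid) (tN _ sT) (tN _ tT).
rewrite lee_fin.
have -> : (N%:R / T) `^ alpha = T `^ (- alpha) * N%:R `^ alpha.
  by rewrite powRM ?invr_ge0 ?ltW// -powR_inv1 ?ltW// -powRrM mulN1r mulrC.
have -> : (8 / (1 - q) + 3) * (1 + 2 * T `^ (- alpha)) * N%:R `^ alpha * M =
  S * N%:R `^ alpha + 2 * S * (T `^ (- alpha) * N%:R `^ alpha).
  by rewrite -SE; ring.
by rewrite lerD2r ler_peMr.
Qed.

(** * Integration *)

(* The integral of a nonnegative function is a supremum over the simple functions
   below it, so no measurability is needed; this avoids proving that the Hölder
   norm is a measurable function of the path. *)
Lemma ge0_le_integral_nonmeasurable (d : measure_display)
    (Omega : measurableType d) (R : realType)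
    (mu : {measure set Omega -> \bar R}) (f g : Omega -> \bar R) :
  (forall w, 0 <= f w)%E -> (forall w, f w <= g w)%E ->
  (\int[mu]_w f w <= \int[mu]_w g w)%E.
Proof.
move=> f0 fg; have g0 w := le_trans (f0 w) (fg w).
rewrite !ge0_integralTE//; apply: le_ereal_sup => _ [h /= hf <-].
by exists h => // w; exact: le_trans (hf w) (fg w).
Qed.

(** Only finitely many pairs of values occur, so each preimage is a finite union of intersections of
    fibres. *)
Lemma measurable_simple_norm (d : measure_display) (Omega : measurableType d)
    (R : realType) (E : normedModType R) (s1 s2 : Omega -> E) :
  simple_function s1 -> simple_function s2 ->
  measurable_fun setT (fun w => `|s1 w - s2 w|).
Proof.
move=> [f1 m1] [f2 m2] _ B _; rewrite setTI.
have -> : (fun w => `|s1 w - s2 w|) @^-1` B =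
    \bigcup_(yz in [set yz | (range s1 `*` range s2) yz /\ B `|yz.1 - yz.2|])
      (s1 @^-1` [set yz.1] `&` s2 @^-1` [set yz.2]).
  apply/seteqP; split=> [w /= Bw|w [[y z] /= [_ Byz] [-> ->]]]//.
  by exists (s1 w, s2 w) => //=; split=> //; split; exists w.
apply: fin_bigcup_measurable => [|[y z] _]; last exact: measurableI.
by apply: sub_finite_set (finite_setX f1 f2) => yz [].
Qed.

Lemma measurable_strongly_norm (d : measure_display) (Omega : measurableType d)
    (R : realType) (E : normedModType R) (Z1 Z2 : Omega -> E) :
  strongly_measurable Z1 -> strongly_measurable Z2 ->
  measurable_fun setT (fun w => `|Z1 w - Z2 w|).
Proof.
move=> [s1 [s1m s1c]] [s2 [s2m s2c]].
apply: (@measurable_fun_cvg _ _ _ _ (fun k w => `|s1 k w - s2 k w|)).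
  by move=> k; exact: measurable_simple_norm.
by move=> w _; apply: cvg_norm; exact: cvgB.
Qed.

Lemma integral_powR_Lp_norm (d : measure_display) (Omega : measurableType d)
    (R : realType) (P : probability Omega R) (E : normedModType R) (p c : R)
    (Z : Omega -> E) : 0 < p -> 0 <= c -> (Lp_norm P p Z <= c%:E)%E ->
  (\int[P]_w (`|Z w| `^ p)%:E <= (c `^ p)%:E)%E.
Proof.
move=> p0 c0 Zc.
have -> : (\int[P]_w (`|Z w| `^ p)%:E = Lp_norm P p Z `^ p)%E.
  rewrite /Lp_norm (poweR_Lnorm P (fun w => `|Z w|%:E) (lt0r_neq0 p0)).
  by apply: eq_integral => w _; rewrite /= normr_id.
rewrite -poweR_EFin; apply: gt0_ler_poweR => //; first exact: ltW.
  by rewrite in_itv/= leey andbT Lnorm_ge0.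
by rewrite in_itv/= leey andbT lee_fin.
Qed.

Lemma nneseries_geometric_le (R : realType) (u : nat -> \bar R) (a r : R) :
  0 <= a -> 0 < r < 1 -> (forall l, 0 <= u l)%E ->
  (forall l, u l <= (a * r ^+ l)%:E)%E ->
  (\sum_(0 <= l <oo) u l <= (a / (1 - r))%:E)%E.
Proof.
move=> a0 /andP[r0 r1] u0 ua.
apply: lime_le; first by apply: is_cvg_nneseries.
apply: nearW => n; apply: (@le_trans _ _ (\sum_(0 <= l < n) (a * r ^+ l)%:E)%E).
  exact: lee_sum.
rewrite sumEFin lee_fin; apply: geometric_le_lim => //.
by rewrite ger0_norm// ltW.
Qed.

(** Nonnegativity allows the integral to pass through both sums. The index type depends on the
    level, since level [l] carries its own finite family of dyadic intervals. *)
Lemma integral_series_le (d : measure_display) (Omega : measurableType d)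
    (R : realType) (mu : {measure set Omega -> \bar R}) (I : nat -> finType)
    (f : forall l, I l -> Omega -> R) (b : nat -> R) (a r : R) :
  (forall l i, measurable_fun setT (f l i)) -> (forall l i w, 0 <= f l i w) ->
  (forall l i, \int[mu]_w (f l i w)%:E <= (b l)%:E)%E ->
  0 <= a -> 0 < r < 1 -> (forall l, #|I l|%:R * b l <= a * r ^+ l) ->
  (\int[mu]_w \sum_(0 <= l <oo) \sum_(i : I l) (f l i w)%:E
     <= (a / (1 - r))%:E)%E.
Proof.
move=> fm f0 fb a0 r01 ba.
rewrite integral_nneseries//; last 2 first.
- by move=> l; apply: emeasurable_sum => i; exact/measurable_EFinP.
- by move=> l w _; apply: sume_ge0 => i _; rewrite lee_fin.
apply: nneseries_geometric_le => // l.
  apply: integral_ge0 => w _; apply: sume_ge0 => i _; by rewrite lee_fin.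
rewrite ge0_integral_sum//; last 2 first.
- by move=> i; exact/measurable_EFinP.
- by move=> i w _; rewrite lee_fin.
apply: (@le_trans _ _ (\sum_(i : I l) (b l)%:E)%E); first exact: lee_sum.
by rewrite sumEFin lee_fin sumr_const -mulr_natl.
Qed.

(** * The moment bound *)

Lemma holder_norm_increment (R : realType) (V : zmodType) (r k : R)
    (D : set R) (nrm : V -> \bar R) (f : R -> V) (x y : R) :
  (holder_norm (M := R^o) r D nrm f <= k%:E)%E -> D x -> D y -> x != y ->
  (nrm (f x - f y)%R <= (k * `|x - y| `^ r)%:E)%E.
Proof.
move=> fk Dx Dy xy.
have h0 : 0 < `|x - y| `^ r by rewrite powR_gt0// normr_gt0 subr_eq0.
rewrite EFinM -lee_pdivrMr//; apply: le_trans fk.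
apply: (@le_trans _ _ (holder_seminorm (M := R^o) r D nrm f)).
  by apply: ereal_sup_ubound; left; exists x, y; rewrite mdist_real.
by apply: leeDr; apply: ereal_sup_ubound; right.
Qed.

(** Makes the bound uniform in [beta], as the final constant is fixed before [beta]: T^beta is
    replaced by 1 + T, and 2^-beta by 2^-eps. The factor N^-beta is kept, as it appears in the
    theorem. *)
Lemma grid_scale_le (R : realType) (T eps beta : R) (N l : nat) :
  0 < T -> (0 < N)%N -> 0 < eps <= beta -> beta <= 1 ->
  (T / N%:R / 2 ^+ l) `^ beta
    <= (1 + T) * N%:R `^ (- beta) * (2 `^ (- eps)) ^+ l.
Proof.
move=> T0 N0 /andP[e0 eb] b1; have NR0 : (0 : R) < N%:R by rewrite ltr0n.
have l0 : (0 : R) < 2 ^+ l by rewrite exprn_gt0.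
have b0 := le_trans (ltW e0) eb.
have T1 : 0 <= 1 + T by rewrite addr_ge0// ltW.
have Ni0 : (0 : R) <= N%:R^-1 by rewrite invr_ge0 ltW.
have li0 : (0 : R) <= 2 ^- l by rewrite invr_ge0 ltW.
have TN0 : 0 <= T / N%:R by rewrite mulr_ge0// ltW.
rewrite (powRM beta TN0 li0) (powRM beta (ltW T0) Ni0).
apply: ler_pM; rewrite ?mulr_ge0 ?powR_ge0//.
  have -> : N%:R^-1 `^ beta = N%:R `^ (- beta).
    by rewrite -(powR_inv1 (ltW NR0)) -powRrM mulN1r.
  apply: ler_wpM2r; first exact: powR_ge0.
  apply: (@le_trans _ _ ((1 + T) `^ beta)).
    by apply: ge0_ler_powR; rewrite ?nnegrE ?lerDr// ltW.
  by apply: ler1_powR => //; rewrite lerDl ltW.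
rewrite -exprVn powR_exprn ?invr_ge0// powR_half.
by apply: lerXn2r; rewrite ?nnegrE ?powR_ge0// ler_powR ?ler1n// lerN2.
Qed.

(** Ratio of the geometric series over levels: the three factors are the number of intervals per
    cell, the weight, and the decay of the moments of the increments. It is below 1 exactly when
    gamma + 1/p < eps. *)
Lemma dyadic_ratio (R : realType) (p gamma eps : R) (l : nat) :
  2 ^+ l * ((2 `^ (- gamma)) ^- l) `^ p * ((2 `^ (- eps)) ^+ l) `^ p =
  (2 `^ (1 + gamma * p - eps * p)) ^+ l.
Proof.
have -> : (2 `^ (- gamma)) ^- l = (2 `^ gamma) ^+ l :> R.
  by rewrite powRN exprVn invrK.
rewrite !powR_exprn ?powR_ge0// -!exprMn; congr (_ ^+ _).
have D x y : 2 `^ (x + y) = 2 `^ x * 2 `^ y :> R.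
  by rewrite powRD// pnatr_eq0 implybT.
by rewrite !D powRr1// -mulNr !powRrM.
Qed.

Section moment.
Context (R : realType) (T : R) (d : measure_display) (Omega : measurableType d).
Context (P : probability Omega R) (E : normedModType R).
Context (X Y : R -> Omega -> E) (N : nat) (p gamma : R).

Definition weighted_increment l (i : 'I_N * 'I_(2 ^ l)) (w : Omega) : R :=
  ((2 `^ (- gamma)) ^- l) `^ p *
  `|X ((i.1%:R + i.2.+1%:R / 2 ^+ l) * T / N%:R) w -
    X ((i.1%:R + i.2%:R / 2 ^+ l) * T / N%:R) w| `^ p.

(* The random variable G of the proof idea above. *)
Definition path_energy (w : Omega) : \bar R :=
  (\sum_(0 <= l <oo) \sum_(i : 'I_N * 'I_(2 ^ l)) (weighted_increment i w)%:E +
   \sum_(n < N.+1) (`|X (n%:R * T / N%:R) w - Y (n%:R * T / N%:R) w| `^ p)%:E)%E.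

Lemma weighted_increment_ge0 l i w : 0 <= @weighted_increment l i w.
Proof. by rewrite mulr_ge0 ?powR_ge0. Qed.

Lemma sum_weighted_increment_ge0 w :
  (0 <= \sum_(0 <= l <oo) \sum_(i : 'I_N * 'I_(2 ^ l)) (weighted_increment i w)%:E)%E.
Proof.
apply: nneseries_ge0 => l _ _; apply: sume_ge0 => i _.
by rewrite lee_fin weighted_increment_ge0.
Qed.

Lemma sum_grid_error_ge0 w :
  (0 <= \sum_(n < N.+1) (`|X (n%:R * T / N%:R) w - Y (n%:R * T / N%:R) w| `^ p)%:E)%E.
Proof. by apply: sume_ge0 => n _; rewrite lee_fin powR_ge0. Qed.

Lemma path_energy_ge0 w : (0 <= path_energy w)%E.
Proof. exact/adde_ge0/sum_grid_error_ge0/sum_weighted_increment_ge0. Qed.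

Lemma weighted_increment_le l i w :
  ((@weighted_increment l i w)%:E <= path_energy w)%E.
Proof.
rewrite /path_energy.
apply: le_trans (leeDl _ (sum_grid_error_ge0 w)).
have i0 m (j : 'I_N * 'I_(2 ^ m)) : (0 <= (weighted_increment j w)%:E)%E.
  by rewrite lee_fin weighted_increment_ge0.
(* The partial sum over the levels below [l.+1] has level [l] as its last summand. *)
apply: le_trans (nneseries_lim_ge l.+1 (fun m _ _ => sume_ge0 (fun j _ => i0 m j) _)).
rewrite big_nat_recr//= (bigD1 i)//= addeCA leeDl// adde_ge0// sume_ge0// => m _.
exact: sume_ge0.
Qed.

Lemma grid_error_le n w : (n <= N)%N ->
  ((`|X (n%:R * T / N%:R) w - Y (n%:R * T / N%:R) w| `^ p)%:E <= path_energy w)%E.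
Proof.
rewrite -ltnS => nN; rewrite /path_energy.
apply: le_trans (leeDr _ (sum_weighted_increment_ge0 w)).
by rewrite (bigD1 (Ordinal nN))//= leeDl// sume_ge0.
Qed.

Lemma holder_norm_le_path_energy alpha w : 0 < T -> (0 < N)%N -> 0 < p ->
  0 < gamma <= 1 -> 0 <= alpha <= gamma ->
  {within `[0, T], continuous (X ^~ w)} ->
  (holder_norm (M := R^o) alpha `[0%R, T] (fun v : E => `|v|%:E)
     (fun t => (X t w - interp T N (Y ^~ w) t)%R) `^ p
   <= (((8 / (1 - 2 `^ (- gamma)) + 3) * (1 + 2 * T `^ (- alpha))
        * N%:R `^ alpha) `^ p)%:E * path_energy w)%E.
Proof.
move=> T0 N0 p0 g01 ag Xc; have /andP[g0 _] := g01.
have NR0 : (0 : R) < N%:R by rewrite ltr0n.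
set c := (8 / _ + 3) * _ * _.
have c0 : 0 < c.
  apply: mulr_gt0; last by rewrite powR_gt0.
  apply: mulr_gt0; last by rewrite ltr_pwDl// mulr_ge0 ?powR_ge0.
  apply: ltr_wpDl => //; apply: mulr_ge0 => //.
  by rewrite invr_ge0 subr_ge0 ltW// powR2_lt1// oppr_lt0.
have := path_energy_ge0 w; move De : (path_energy w) => e.
case: e De => [s De|De _|//]; last by rewrite mulry gtr0_sg ?powR_gt0// mul1e leey.
rewrite lee_fin => s0.
have root x : 0 <= x -> x `^ p <= s -> x <= s `^ p^-1.
  move=> x0 xs; rewrite -[x]powRr1// -(@mulfV _ p) ?gt_eqF// powRrM.
  by apply: ge0_ler_powR; rewrite ?nnegrE ?invr_ge0 ?powR_ge0// ltW.
have q0 : 0 < 2 `^ (- gamma) :> R by rewrite powR_gt0.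
have := @holder_norm_interp_error_le R E T N (X ^~ w) (Y ^~ w) gamma alpha
  (s `^ p^-1) T0 N0 g01 ag (powR_ge0 _ _) Xc.
set h := holder_norm _ _ _ _ => hle.
have {}hle : (h <= (c * s `^ p^-1)%:E)%E.
  apply: hle => [l n j nN jl|n nN].
    rewrite -ler_pdivrMr ?exprn_gt0// mulrC; apply: root.
      by rewrite mulr_ge0// invr_ge0 exprn_ge0// ltW.
    rewrite powRM ?invr_ge0 ?exprn_ge0 ?(ltW q0)// -lee_fin -De.
    exact: (weighted_increment_le (Ordinal nN, Ordinal jl)).
  by apply: root => //; rewrite -lee_fin -De; exact: grid_error_le.
have h0 : (0 <= h)%E.
  by apply: adde_ge0; apply: ereal_sup_ubound; right.
apply: (@le_trans _ _ ((c * s `^ p^-1)%:E `^ p)%E).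
  apply: gt0_ler_poweR => //; first exact: ltW.
    by rewrite in_itv/= h0 leey.
  by rewrite in_itv/= leey andbT lee_fin mulr_ge0 ?powR_ge0// ltW.
rewrite poweR_EFin powRM ?powR_ge0 ?(ltW c0)// -powRrM mulVf ?gt_eqF//.
by rewrite powRr1.
Qed.

Hypotheses (T0 : 0 < T) (N0 : (0 < N)%N) (p0 : 0 < p).
Hypothesis Xm : forall t : R, t \in `[0, T] -> strongly_measurable (X t).
Hypothesis Ym : forall t : R, t \in `[0, T] -> strongly_measurable (Y t).

Lemma grid_in_itv (x : R) : 0 <= x <= N%:R -> x * T / N%:R \in `[0, T].
Proof.
move=> /andP[x0 x1]; have NR0 : (0 : R) < N%:R by rewrite ltr0n.
rewrite in_itv/=; apply/andP; split.
  by rewrite divr_ge0 ?mulr_ge0// ltW.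
by rewrite ler_pdivrMr// mulrC ler_pM2l.
Qed.

Lemma cell_in_itv l (i : 'I_N * 'I_(2 ^ l)) (j : nat) : (j <= 2 ^ l)%N ->
  0 <= (i.1%:R + j%:R / 2 ^+ l : R) <= N%:R.
Proof.
move=> jl; rewrite addr_ge0 ?divr_ge0 ?exprn_ge0//=.
apply: (@le_trans _ _ i.1.+1%:R); last by rewrite ler_nat.
by rewrite -[leRHS]natr1 lerD2l ler_pdivrMr ?exprn_gt0// mul1r -natrX ler_nat.
Qed.

Lemma measurable_powR_norm (s t : R) (Z1 Z2 : R -> Omega -> E) :
  strongly_measurable (Z1 s) -> strongly_measurable (Z2 t) ->
  measurable_fun setT (fun w => `|Z1 s w - Z2 t w| `^ p).
Proof.
move=> Z1m Z2m; apply: (measurableT_comp (measurable_powR p)).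
exact: measurable_strongly_norm.
Qed.

Lemma measurable_weighted_increment l i :
  measurable_fun setT (@weighted_increment l i).
Proof.
apply: measurable_funM; first exact: measurable_cst.
by apply: measurable_powR_norm; apply: Xm; apply: grid_in_itv; apply: cell_in_itv;
  rewrite // ltnW.
Qed.

Lemma measurable_sum_weighted_increment : measurable_fun setT (fun w =>
  (\sum_(0 <= l <oo) \sum_(i : 'I_N * 'I_(2 ^ l)) (weighted_increment i w)%:E)%E
    : \bar R).
Proof.
apply: ge0_emeasurable_sum => [l w _ _|l _].
  by apply: sume_ge0 => i _; rewrite lee_fin weighted_increment_ge0.
apply: emeasurable_sum => i; apply/measurable_EFinP.
exact: measurable_weighted_increment.
Qed.

Lemma measurable_grid_error (n : 'I_N.+1) : measurable_fun setT (fun w =>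
  (`|X (n%:R * T / N%:R) w - Y (n%:R * T / N%:R) w| `^ p)%:E).
Proof.
apply/measurable_EFinP.
have nT : n%:R * T / N%:R \in `[0, T].
  by apply: grid_in_itv; rewrite ler0n ler_nat -ltnS /=.
by apply: measurable_powR_norm; [exact: Xm|exact: Ym].
Qed.

Lemma measurable_path_energy : measurable_fun setT path_energy.
Proof.
apply: emeasurable_funD; first exact: measurable_sum_weighted_increment.
by apply: emeasurable_sum => n; exact: measurable_grid_error.
Qed.

Lemma integral_path_energy_le (eps beta a k : R) :
  0 < eps <= beta -> beta <= 1 -> 0 <= a -> 0 <= k -> 1 + gamma * p < eps * p ->
  (forall n, (n <= N)%N ->
    Lp_norm P p (X (n%:R * T / N%:R) - Y (n%:R * T / N%:R))%R <= a%:E)%E ->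
  (holder_norm (M := R^o) beta `[0%R, T] (Lp_norm P p) X <= k%:E)%E ->
  (\int[P]_w path_energy w <=
    (N%:R * ((1 + T) * (N%:R `^ (- beta) * k)) `^ p
       / (1 - 2 `^ (1 + gamma * p - eps * p)) + N.+1%:R * a `^ p)%:E)%E.
Proof.
move=> eb b1 a0 k0 gp Da Xk; have /andP[e0 _] := eb.
have NR0 : (0 : R) < N%:R by rewrite ltr0n.
rewrite /path_energy ge0_integralD//; last 4 first.
- by move=> w _; exact: sum_weighted_increment_ge0.
- exact: measurable_sum_weighted_increment.
- by move=> w _; exact: sum_grid_error_ge0.
- by apply: emeasurable_sum => n; exact: measurable_grid_error.
rewrite EFinD; apply: leeD; last first.
  rewrite ge0_integral_sum//; last first.
    by move=> n; exact: measurable_grid_error.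
  apply: (@le_trans _ _ (\sum_(n < N.+1) (a `^ p)%:E)%E).
    apply: lee_sum => n _.
    have := integral_powR_Lp_norm p0 a0 (Da n _); apply.
    by rewrite -ltnS.
  by rewrite sumEFin lee_fin sumr_const card_ord mulr_natl.
(* Common bound for the expected weighted increments of level [l]: the interval length is
   [T / N%:R / 2 ^+ l], and [k] bounds the [beta]-Hölder norm of [X] in L^p. *)
pose b l := ((2 `^ (- gamma)) ^- l) `^ p * (k * (T / N%:R / 2 ^+ l) `^ beta) `^ p.
apply: (@integral_series_le _ _ _ P (fun l => ('I_N * 'I_(2 ^ l))%type)
  weighted_increment b).
- exact: measurable_weighted_increment.
- exact: weighted_increment_ge0.
- move=> l i.
  set t := (i.1%:R + i.2.+1%:R / 2 ^+ l) * T / N%:R.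
  set s := (i.1%:R + i.2%:R / 2 ^+ l) * T / N%:R.
  have tT : t \in `[0, T] by apply: grid_in_itv; exact: cell_in_itv.
  have sT : s \in `[0, T] by apply: grid_in_itv; apply: cell_in_itv; exact: ltnW.
  have tsE : t - s = T / N%:R / 2 ^+ l.
    rewrite /t /s -natr1; field; rewrite (gt_eqF NR0)/=.
    by rewrite expf_neq0.
  have h0 : 0 < t - s by rewrite tsE !divr_gt0// exprn_gt0.
  under eq_integral do rewrite /weighted_increment EFinM.
  rewrite ge0_integralZl_EFin ?powR_ge0//; last first.
    apply/measurable_EFinP.
    by apply: measurable_powR_norm; exact: Xm.
  rewrite -/t -/s.
  rewrite /b EFinM lee_wpmul2l ?lee_fin ?powR_ge0// -tsE.
  apply: integral_powR_Lp_norm; rewrite ?mulr_ge0 ?powR_ge0//.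
  rewrite -(ger0_norm (ltW h0)).
  by apply: holder_norm_increment Xk _ _ _ => //; rewrite -subr_eq0 gt_eqF.
- by rewrite mulr_ge0 ?powR_ge0.
- by rewrite powR_gt0//= powR2_lt1// subr_lt0.
(* Level [l] has [N * 2 ^ l] intervals; the factor 2^l enters the geometric ratio, while [N] remains
   in the constant of the series. *)
move=> l; rewrite card_prod !card_ord natrM natrX -dyadic_ratio /b.
have -> : N%:R * 2 ^+ l * (((2 `^ (- gamma)) ^- l) `^ p *
      (k * (T / N%:R / 2 ^+ l) `^ beta) `^ p) =
    (N%:R * (2 ^+ l * ((2 `^ (- gamma)) ^- l) `^ p)) *
      (k * (T / N%:R / 2 ^+ l) `^ beta) `^ p :> R by ring.
have -> : forall x y z u v : R, x * y * (z * u * v) = (x * (z * u)) * (y * v).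
  by move=> *; ring.
apply: ler_wpM2l.
  by rewrite !mulr_ge0 ?powR_ge0 ?exprn_ge0.
have u0 : 0 <= (1 + T) * (N%:R `^ (- beta) * k).
  by rewrite !mulr_ge0 ?powR_ge0 ?addr_ge0// ltW.
have v0 : 0 <= (2 `^ (- eps)) ^+ l :> R by rewrite exprn_ge0// powR_ge0.
rewrite -(powRM p u0 v0).
apply: ge0_ler_powR; rewrite ?nnegrE ?(ltW p0)//.
- by rewrite mulr_ge0 ?powR_ge0.
- exact: mulr_ge0.
have -> : (1 + T) * (N%:R `^ (- beta) * k) * (2 `^ (- eps)) ^+ l =
  k * ((1 + T) * N%:R `^ (- beta) * (2 `^ (- eps)) ^+ l) by ring.
by apply: ler_wpM2l => //; exact: grid_scale_le.
Qed.

End moment.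

(** * Collecting constants and conclusion *)

Lemma moment_constant_le (R : realType) (T : R) (N : nat) (p eps alpha r c a b : R) :
  0 < T -> (0 < N)%N -> 1 < p -> alpha < eps - 1 / p -> r < 1 ->
  0 <= c -> 0 <= a -> 0 <= b ->
  (c * N%:R `^ alpha) `^ p *
    (N%:R * ((1 + T) * b) `^ p / (1 - r) + N.+1%:R * a `^ p)
  <= (c * ((1 + T) `^ p / (1 - r) + 2) * N%:R `^ eps * (a + b)) `^ p.
Proof.
move=> T0 N0 p1 ae r1 c0 a0 b0.
have p0 : 0 < p by apply: lt_trans p1.
have NR1 : (1 : R) <= N%:R by rewrite ler1n.
have T1 : 0 <= 1 + T by rewrite addr_ge0// ltW.
set D := (1 + T) `^ p / (1 - r).
have D0 : 0 <= D by rewrite divr_ge0 ?powR_ge0// subr_ge0 ltW.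
have ab0 : 0 <= a + b by rewrite addr_ge0.
have mono x : 0 <= x -> x <= a + b -> x `^ p <= (a + b) `^ p.
  by move=> x0 xab; apply: ge0_ler_powR; rewrite ?nnegrE// ltW.
have ap : a `^ p <= (a + b) `^ p by apply: mono => //; rewrite lerDl.
have bp : b `^ p <= (a + b) `^ p by apply: mono => //; rewrite lerDr.
have inner : N%:R * ((1 + T) * b) `^ p / (1 - r) + N.+1%:R * a `^ p <=
    N%:R * ((D + 2) * (a + b) `^ p).
  have -> : N%:R * ((1 + T) * b) `^ p / (1 - r) = N%:R * (D * b `^ p).
    by rewrite powRM// /D; ring.
  apply: (@le_trans _ _ (N%:R * (D * b `^ p) + N%:R * (2 * a `^ p))).
    (* The N + 1 grid points are counted as at most 2N, which is the origin of the 2 in [D + 2]. *)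
    rewrite lerD2l mulrA ler_wpM2r ?powR_ge0// mulrC mulr_natl mulr2n -natr1.
    by rewrite lerD2l.
  rewrite -mulrDr ler_wpM2l ?ler0n// [(D + 2) * _]mulrDl.
  by apply: lerD; apply: ler_wpM2l.
apply: (le_trans (ler_wpM2l (powR_ge0 _ _) inner)).
have -> : (c * (D + 2) * N%:R `^ eps * (a + b)) `^ p =
    c `^ p * (D + 2) `^ p * (N%:R `^ eps) `^ p * (a + b) `^ p.
  by rewrite !powRM ?mulr_ge0 ?powR_ge0 ?addr_ge0.
rewrite powRM ?powR_ge0//.
have AC (x y z u v : R) : x * y * (z * (u * v)) = x * u * (z * y) * v by ring.
rewrite [leLHS]AC.
rewrite ler_wpM2r ?powR_ge0// ler_pM ?mulr_ge0 ?powR_ge0 ?addr_ge0//.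
  (* As [D + 2] is at least 1 and [p] exceeds 1, [D + 2] is at most its own p-th power and can be
     moved under the root. *)
  rewrite ler_wpM2l ?powR_ge0//; apply: le1r_powR; last exact: ltW.
  by rewrite ler_wpDl// ler1n.
(* What remains is alpha p + 1 <= eps p: the single factor [N], from counting cells and grid points,
   is paid for by the gap between [alpha] and [eps - 1 / p]. *)
rewrite -!powRrM -{1}[N%:R](powRr1 (ler0n _ _)) -powRD; last first.
  by rewrite pnatr_eq0 -lt0n N0 implybT.
apply: ler_powR => //.
have : alpha * p < (eps - 1 / p) * p by rewrite ltr_pM2r.
by rewrite mulrBl divfK ?gt_eqF// ltrBrDl => /ltW.
Qed.

Lemma poweR_1div_le (R : realType) (x : \bar R) (y p : R) :
  0 < p -> 0 <= y -> (0 <= x <= (y `^ p)%:E)%E -> (x `^ (1 / p) <= y%:E)%E.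
Proof.
move=> p0 y0 /andP[x0 xy].
have -> : y%:E = ((y `^ p)%:E `^ (1 / p))%E.
  by rewrite poweR_EFin -powRrM mulrC divfK ?gt_eqF// powRr1.
apply: gt0_ler_poweR => //; first by rewrite divr_ge0// ltW.
  by rewrite in_itv/= x0 leey.
by rewrite in_itv/= leey andbT lee_fin powR_ge0.
Qed.

Theorem theorem1p1 (R : realType) (T : R) (hT : 0 < T)
    (d : measure_display) (Omega : measurableType d) (P : probability Omega R)
    (E : completeNormedModType R)
    (p : R) (hp : 1 < p)
    (eps : R) (heps : 1 / p < eps <= 1)
    (alpha : R) (halpha : 0 <= alpha < eps - 1 / p) :
  exists C : R, 0 < C /\
    forall (beta : R) (hbeta : eps <= beta <= 1) (N : nat) (hN : (0 < N)%N)
      (X Y : R -> Omega -> E)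
      (hXm : forall t : R, t \in `[0, T] -> strongly_measurable (X t))
      (hYm : forall t : R, t \in `[0, T] -> strongly_measurable (Y t))
      (hXc : forall w, {within `[0, T], continuous (fun t => X t w)})
      (hYc : forall w, {within `[0, T], continuous (fun t => Y t w)}),
    ((\int[P]_w
        (holder_norm (M := R^o) alpha `[0%R, T] (fun v : E => `|v|%:E)
           (fun t => (X t w - interp T N (fun s => Y s w) t)%R) `^ p))
       `^ (1 / p)
     <= (C * N%:R `^ eps)%:E *
        (ereal_sup [set Lp_norm P p
              (X (n%:R * T / N%:R) - Y (n%:R * T / N%:R))%R
            | n in [set n : nat | (n <= N)%N]]
         + (N%:R `^ (- beta))%:E *
           holder_norm (M := R^o) beta `[0%R, T] (Lp_norm P p) X))%E.
Proof.
have /andP[eps1 eps2] := heps; have /andP[a0 a1] := halpha.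
have p0 : 0 < p by apply: lt_trans hp.
have ip0 : 0 < 1 / p by rewrite divr_gt0.
have eps0 : 0 < eps by exact: lt_trans eps1.
(* The midpoint is positive even for [alpha = 0], and lies strictly below [eps - 1 / p], which makes
   the series over levels converge. *)
pose gamma := (alpha + (eps - 1 / p)) / 2.
have g01 : 0 < gamma <= 1 by rewrite /gamma; apply/andP; split; lra.
have ag : 0 <= alpha <= gamma by rewrite /gamma; apply/andP; split; lra.
have gp : 1 + gamma * p < eps * p.
  have : gamma * p < (eps - 1 / p) * p by rewrite ltr_pM2r// /gamma; lra.
  by rewrite mulrBl divfK ?gt_eqF// ltrBrDl.
have /andP[g0 g1] := g01.
pose r : R := 2 `^ (1 + gamma * p - eps * p).
have r1 : r < 1 by rewrite powR2_lt1// subr_lt0.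
pose c := (8 / (1 - 2 `^ (- gamma)) + 3) * (1 + 2 * T `^ (- alpha)).
have c0 : 0 < c.
  apply: mulr_gt0; last by rewrite ltr_pwDl// mulr_ge0 ?powR_ge0.
  apply: ltr_wpDl => //; apply: mulr_ge0 => //.
  by rewrite invr_ge0 subr_ge0 ltW// powR2_lt1// oppr_lt0.
have C0 : 0 < c * ((1 + T) `^ p / (1 - r) + 2).
  by rewrite mulr_gt0// ltr_wpDl// divr_ge0 ?powR_ge0// subr_ge0 ltW.
exists (c * ((1 + T) `^ p / (1 - r) + 2)); split=> // beta /andP[be b1] N N0.
move=> X Y Xm Ym Xc _.
have NR0 : (0 : R) < N%:R by rewrite ltr0n.
set A := ereal_sup _; set K := holder_norm (M := R^o) beta _ _ X.
have A0 : (0 <= A)%E.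
  apply: (@le_trans _ _ (Lp_norm P p (X (0%:R * T / N%:R) - Y (0%:R * T / N%:R))%R)).
    exact: Lnorm_ge0.
  by apply: ereal_sup_ubound; exists 0.
have K0 : (0 <= K)%E by apply: adde_ge0; apply: ereal_sup_ubound; right.
have nu0 : 0 < N%:R `^ (- beta) :> R by rewrite powR_gt0.
have CN0 : 0 < c * ((1 + T) `^ p / (1 - r) + 2) * N%:R `^ eps.
  by rewrite mulr_gt0// powR_gt0.
have nuK0 : (0 <= (N%:R `^ (- beta))%:E * K)%E.
  by rewrite mule_ge0// lee_fin ltW.
have neqNy x : (0 <= x :> \bar R)%E -> x != -oo%E.
  by move=> x0; rewrite -ltNye (lt_le_trans _ x0).
(* If either term on the right is infinite the claim is trivial, both terms being nonnegative and
   the coefficients positive. Otherwise all bounds are real numbers. *)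
have [Ay|Afin] := eqVneq A +oo%E.
  by rewrite Ay addye ?neqNy// gt0_muley ?leey ?lte_fin.
have [Ky|Kfin] := eqVneq K +oo%E.
  rewrite Ky (gt0_muley (_ : 0 < (N%:R `^ (- beta))%:E)%E) ?lte_fin//.
  rewrite addey ?neqNy//.
  by rewrite gt0_muley ?leey ?lte_fin.
have [a Aa] : exists a, A = a%:E.
  by exists (fine A); rewrite fineK// ge0_fin_numE// ltey.
have [k Kk] : exists k, K = k%:E.
  by exists (fine K); rewrite fineK// ge0_fin_numE// ltey.
rewrite Aa lee_fin in A0; rewrite Kk lee_fin in K0.
rewrite Aa Kk -(EFinM (N%:R `^ (- beta)) k) -EFinD -EFinM.
apply: poweR_1div_le => //.
  by rewrite mulr_ge0 ?(ltW CN0)// addr_ge0// mulr_ge0// ltW.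
apply/andP; split; first by apply: integral_ge0 => w _; exact: poweR_ge0.
(* Pointwise majorant of the integrand; [path_energy] is measurable, so the constant can be taken
   out of its integral. *)
pose f w := (((c * N%:R `^ alpha) `^ p)%:E * path_energy T X Y N p gamma w)%E.
apply: (le_trans (@ge0_le_integral_nonmeasurable _ _ _ P _ f _ _)) => [w|w|].
- exact: poweR_ge0.
- exact: holder_norm_le_path_energy.
have mE : measurable_fun setT (path_energy T X Y N p gamma).
  exact: measurable_path_energy.
rewrite /f ge0_integralZl_EFin ?powR_ge0//; last by move=> w _; exact: path_energy_ge0.
have eb : 0 < eps <= beta by rewrite eps0.
have Da n : (n <= N)%N ->
    (Lp_norm P p (X (n%:R * T / N%:R) - Y (n%:R * T / N%:R))%R <= a%:E)%E.
  by move=> nN; rewrite -Aa; apply: ereal_sup_ubound; exists n.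
have XK : (holder_norm (M := R^o) beta `[0%R, T] (Lp_norm P p) X <= k%:E)%E.
  by rewrite -/K Kk.
have D := integral_path_energy_le hT N0 p0 Xm Ym eb b1 A0 K0 gp Da XK.
apply: (le_trans (lee_wpmul2l _ D)); first by rewrite lee_fin powR_ge0.
rewrite -EFinM lee_fin; apply: moment_constant_le => //; first exact: ltW.
by rewrite mulr_ge0// ltW.
Qed.
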